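(* Let $X$ be an infinite-dimensional complex Banach space and let $T$ be a generalized Drazin invertible bounded linear operator on $X$ with generalized Drazin inverse $T^D$. Then $T$ has property $(\beta)$ if and only if $T^D$ has property $(\beta)$.
   Context: A bounded operator $T$ on $X$ is generalized Drazin invertible if there is a bounded operator $S$ on $X$ with $ST=TS$, $STS=S$ and $TST=T+U$ with $U$ quasinilpotent (equivalently, $0$ is not an accumulation point of $\sigma(T)$). Such $S$ is unique; it is called the generalized Drazin inverse of $T$ and denoted $T^D$. $T$ has (Bishop's) property $(\beta)$ if for every open set $\mathcal{U}\subseteq\mathbb{C}$ and every sequence of analytic functions $f_n:\mathcal{U}\to X$ for which $(\lambda I-T)f_n(\lambda)\to0$ uniformly on all compact subsets of $\mathcal{U}$, also $f_n(\lambda)\to0$ uniformly on all compact subsets of $\mathcal{U}$. *)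

(* Defs.v *)
From HB Require Import structures.
From mathcomp Require Import all_boot all_order all_algebra.
From mathcomp Require Import complex.
From mathcomp Require Import all_classical all_reals topology normedtype sequences.

Set Implicit Arguments.
Unset Strict Implicit.
Unset Printing Implicit Defensive.

Import Order.TTheory GRing.Theory Num.Theory.
Import numFieldNormedType.Exports.

Local Open Scope classical_set_scope.
Local Open Scope ring_scope.

Section operators.
Context {K : numFieldType} {X : normedModType K}.
Implicit Types (T S Q : {linear X -> X}) (U : set K) (f : K -> X).

Definition infinite_dimensional (V : lmodType K) : Prop :=
  ~ exists (n : nat) (e : 'I_n -> V),
      forall x : V, exists c : 'I_n -> K, x = \sum_(i < n) c i *: e i.

Definition bounded_operator T : Prop :=
  exists M : K, forall x, `|T x| <= M * `|x|.

(* Invertibility of z I - T is taken in the algebra of bounded operators. *)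
Definition spectrum T : set K :=
  [set z | ~ exists2 S : {linear X -> X}, bounded_operator S &
      (forall x, S (z *: x - T x) = x) /\
      (forall x, z *: S x - T (S x) = x)].

Definition quasinilpotent Q : Prop := spectrum Q = [set 0].

Definition generalized_drazin_inverse T S : Prop :=
  [/\ bounded_operator S,
      forall x, S (T x) = T (S x),
      forall x, S (T (S x)) = S x &
      exists Q : {linear X -> X}, [/\ bounded_operator Q, quasinilpotent Q &
        forall x, T (S (T x)) = T x + Q x]].

(* A function on an open set U is represented by a total function, of which
   only the values on U matter. *)
Definition analytic_on U f : Prop :=
  forall z0, U z0 -> exists a : nat -> X,
    \forall z \near z0, series (fun k => (z - z0) ^+ k *: a k) @ \oo --> f z.

Definition cvg_compacts_to0 U (g : nat -> K -> X) : Prop :=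
  forall A : set K, compact A -> A `<=` U ->
    {uniform A, g @ \oo --> (fun=> 0 : X)}.

Definition property_beta T : Prop :=
  forall U : set K, open U ->
  forall f : nat -> K -> X, (forall n, analytic_on U (f n)) ->
    cvg_compacts_to0 U (fun n z => z *: f n z - T (f n z)) ->
    cvg_compacts_to0 U f.

End operators.

(* Main.v *)
Require Import Defs.
From HB Require Import structures.
From mathcomp Require Import all_boot all_order all_algebra.
From mathcomp Require Import complex ring.
From mathcomp Require Import all_classical all_reals topology normedtype sequences.

Set Implicit Arguments.
Unset Strict Implicit.
Unset Printing Implicit Defensive.

Import Order.TTheory GRing.Theory Num.Theory.
Import numFieldNormedType.Exports.

Local Open Scope classical_set_scope.
Local Open Scope ring_scope.
Local Open Scope complex_scope.

(** Write S for the generalized Drazin inverse of T.  The operator TS is a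
bounded idempotent commuting with T and S.  On its range T and S are inverse to
each other; on its kernel S is 0 and T is -Q, with Q quasinilpotent.  Property
(beta) for one of the operators A, B = T, S is transferred to the other
([property_beta_transfer]) by splitting f_n = A B f_n + (f_n - A B f_n).

On the range (g_n = A B f_n), (w - B) g_n(w) -> 0 becomes (mu - A) h_n(mu) -> 0
for h_n(mu) = g_n(1/mu), because mu - A = -mu A (1/mu - B) there.  So property
(beta) of A gives g_n -> 0 away from the origin, while at the origin g_n is
controlled directly since B is bounded below on the range
([property_beta_vanishes_inverse]).

On the kernel (q_n = f_n - A B f_n), z - B is bounded below for every nonzero z,
since the spectrum is contained in {0}; a lower bound at z persists near z, so
q_n -> 0 locally uniformly off the origin ([vanishes_at_bounded_below]).  The
maximum principle on a small circle extends this to the origin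
([vanishes_at_removable]).

Two pieces of complex analysis are needed for functions that are given only by
local power series, and neither uses integration.  Analyticity of mu |-> f(1/mu)
is an explicit rearrangement of power series ([analytic_on_inv]).  The maximum
principle ([maximum_modulus]) comes from averaging f over the four vertices of
a small square, which kills the Taylor terms of degree 1 and 2, against the
strictly subharmonic perturbation e |z - c|^2.

Uniform convergence on compact sets is handled as a pointwise condition, the
joint limit of g_n(w) as n -> oo and w -> z ([cvg_compacts_to0P]); this is where
local compactness of the scalar field enters.  The argument runs over any
numerical algebraically closed field whose closed discs are compact, and is
specialised to R[i] at the end. *)

(** * Compactness and locally uniform convergence *)
Definition compact_discs (K : numFieldType) :=
  forall (z r : K), compact [set w : K | `|w - z| <= r].

(** The order of [K] is only partial, as for the complex numbers, so the supremum
of [u] on [D] need not make sense beforehand; instead, if no value were maximal,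
the near-covering property of [D] would give a single value of [u] above all
those taken on [D], itself included. *)
Lemma compact_has_max (K : numFieldType) (T : topologicalType) (D : set T)
    (u : T -> K) :
  compact D -> D !=set0 -> (forall z, D z -> {for z, continuous u}) ->
  (forall z, u z \is Num.real) ->
  exists2 z, D z & forall w, D w -> u w <= u z.
Proof.
move=> cD [d0 Dd0] cu ur; apply: contrapT => nomax.
have larger z : D z -> exists2 b, D b & u z < u b.
  move=> Dz; apply: contrapT => nob; apply: nomax; exists z => // w Dw.
  rewrite real_leNgt//; apply/negP => zw; apply: nob; by exists w.
(* The final segments of the values of u form the filter used for the covering. *)
pose above b := [set c | D c /\ u b <= u c].
have FF : Filter (filter_from D above).
  apply: filter_from_filter; first by exists d0.
  move=> b c Db Dc; have [bc|cb] := real_leP (ur b) (ur c).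
    by exists c => // e [De ce]; do !split => //; exact: le_trans ce.
  by exists b => // e [De ce]; do !split => //; exact: le_trans (ltW cb) ce.
have /compact_near_coveringP/near_covering_withinP := cD.
move=> /(_ _ (filter_from D above) (fun c z => u z < u c) FF) [].
  move=> z Dz; have [b Db zb] := larger z Dz.
  have d_gt0 : 0 < u b - u z by rewrite subr_gt0.
  exists ([set z' | `|u z - u z'| < u b - u z], above b) => /=.
    split; last by exists b.
    by move/cvgrPdist_lt: (cu z Dz); apply.
  move=> [z' c] /= [zz' [Dc bc]] Dz'; apply: lt_le_trans bc.
  move: zz'; rewrite distrC real_ltr_distl ?rpredB// => /andP[_].
  by rewrite addrC subrK.
move=> b Db /(_ b) /=; rewrite /above /=.
by move=> /(_ (conj Db (lexx _)) b Db); rewrite ltxx.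
Qed.

Section local_uniform.
Context {K : numFieldType} {X : normedModType K}.
Implicit Types (U : set K) (g h : nat -> K -> X).

(** The limit is taken jointly in [n] and [w]: the neighbourhood of [z] may depend
on [e], which local compactness makes harmless. *)
Definition vanishes_at g (z : K) :=
  forall e : K, 0 < e -> \forall n \near \oo & w \near z, `|g n w| < e.

Lemma near_dist_lt (z r : K) : 0 < r -> \forall w \near z, `|w - z| < r.
Proof. by move=> r0; apply/nbhs_normP; exists r => // w; rewrite distrC. Qed.

Lemma uniform_cvg0P (A : set K) g :
  {uniform A, g @ \oo --> (fun=> 0 : X)} <->
  forall e : K, 0 < e -> \forall n \near \oo, forall w, A w -> `|g n w| < e.
Proof.
split=> [cvg_g e e0|g0 P].
  apply: (cvg_g [set h : {uniform` A -> X} | forall w, A w -> `|h w| < e]).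
  apply/uniform_nbhs.
  exists [set xy : X * X | ball xy.1 e xy.2]; split.
    by rewrite -entourage_from_ballE; exists e.
  by move=> h /= hA w /hA; rewrite -ball_normE /= sub0r normrN.
move=> /uniform_nbhs [E [entE EP]].
move: entE; rewrite -entourage_from_ballE => -[e /= e0 eE].
rewrite near_simpl /=.
apply: filterS (g0 e e0) => n gn; apply: EP => /= w /gn gnw.
by apply: eE => /=; rewrite -ball_normE /= sub0r normrN.
Qed.

(** From right to left, near-covering of a compact set by the joint
neighbourhoods; from left to right, convergence is tested on one compact disc
around [z] inside [U]. *)
Lemma cvg_compacts_to0P U g : compact_discs K -> open U ->
  cvg_compacts_to0 U g <-> forall z, U z -> vanishes_at g z.
Proof.
move=> cK oU; split=> [cvg_g z Uz e e0|van A cA AU].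
  have /nbhs_normP[r /= r0 rU] : nbhs z U by exact: open_nbhs_nbhs.
  have DU : [set w | `|w - z| <= r / 2] `<=` U.
    move=> w /= wr; apply: rU; rewrite /= distrC (le_lt_trans wr)//.
    by rewrite gtr_pMr// invf_lt1// ltr1n.
  have /uniform_cvg0P/(_ e e0) gD := cvg_g _ (cK z (r / 2)) DU.
  exists ([set n | forall w, `|w - z| <= r / 2 -> `|g n w| < e],
          [set w | `|w - z| <= r / 2]) => /=.
    split => //; apply/nbhs_normP; exists (r / 2); rewrite /= ?divr_gt0//.
    by move=> w /= /ltW; rewrite distrC.
  by move=> [n w] /= [gn /gn].
apply/uniform_cvg0P => e e0.
have /compact_near_coveringP := cA.
move=> /(_ _ \oo (fun n w => `|g n w| < e) _); apply.
move=> z /AU/van/(_ e e0) [[P Q] /= [Po Qz] PQ].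
by exists (Q, P) => // -[w n] [/= Qw Pn]; exact: (PQ (n, w)).
Qed.

Lemma vanishes_at_le g h (C : K) z :
  (\forall n \near \oo & w \near z, `|h n w| <= C * `|g n w|) ->
  vanishes_at g z -> vanishes_at h z.
Proof.
move=> hg g0 e e0.
have C0 : 0 < `|C| + 1 by rewrite ltr_wpDl.
apply: filterS2 hg (g0 (e / (`|C| + 1)) _); last by rewrite divr_gt0.
move=> [n w] /= hCg; rewrite ltr_pdivlMr// mulrC; apply: le_lt_trans.
apply: (le_trans hCg); have [->|gn0] := eqVneq (g n w) 0.
  by rewrite normr0 !mulr0.
have : 0 <= C * `|g n w| by rewrite (le_trans _ hCg).
rewrite pmulr_lge0 ?normr_gt0// => C_ge0.
by rewrite ler_wpM2r// ger0_norm// lerDl.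
Qed.

Lemma vanishes_atD g h z : vanishes_at g z -> vanishes_at h z ->
  vanishes_at (fun n w => g n w + h n w) z.
Proof.
move=> g0 h0 e e0; have e2 : 0 < e / 2 by rewrite divr_gt0.
apply: filterS2 (g0 _ e2) (h0 _ e2) => -[n w] /= ge he.
by rewrite (splitr e) (le_lt_trans (ler_normD _ _))// ltrD.
Qed.

Lemma vanishes_at_comp g (phi : K -> K) z : {for z, continuous phi} ->
  vanishes_at g (phi z) -> vanishes_at (fun n w => g n (phi w)) z.
Proof.
move=> cphi g0 e e0; have [[P Q] /= [Po Qz] PQ] := g0 e e0.
exists (P, phi @^-1` Q) => /=; first by split => //; exact: cphi.
by move=> [n w] /= [Pn Qw]; exact: (PQ (n, phi w)).
Qed.

End local_uniform.

(** * Local power series *)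
Section power_series.
Context {K : numFieldType} {X : normedModType K}.
Implicit Types (a : nat -> X) (f : K -> X) (z h : K).

Lemma cvg_norm_le_bound (u : nat -> X) (l : X) (M : K) : M \is Num.real ->
  u @ \oo --> l -> (\forall n \near \oo, `|u n| <= M) -> `|l| <= M.
Proof.
move=> Mr ul uM; rewrite real_leNgt ?normr_real//; apply/negP => Ml.
have : \forall n \near \oo, False.
  apply: filterS2 uM (cvgr_norm_gt _ ul _ Ml) => n un Mn.
  by have := lt_le_trans Mn un; rewrite ltxx.
by move=> /filter_ex[].
Qed.

Lemma sum_geometric_le2 (x : K) n : 0 <= x -> x <= 2^-1 ->
  \sum_(i < n) x ^+ i <= 2.
Proof.
move=> x0 x2; have x1 : 2^-1 <= 1 - x.
  by rewrite lerBrDr (le_trans (lerD (lexx _) x2))// -div1r -splitr.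
have : (1 - x) * (\sum_(i < n) x ^+ i) <= 1.
  rewrite -[1 - x]opprB mulNr -subrX1 opprB.
  by rewrite gerBl exprn_ge0.
move=> H; have S0 : 0 <= \sum_(i < n) x ^+ i.
  by apply: sumr_ge0 => i _; rewrite exprn_ge0.
rewrite -[leRHS]mul1r -ler_pdivrMr// mulrC; apply: le_trans H.
by rewrite ler_wpM2r.
Qed.

(** Cauchy-type estimates without Cauchy: the terms of the series converging at
[z + r] are bounded. *)
Lemma analytic_on_coef_bound U f z : analytic_on U f -> U z ->
  exists a : nat -> X, exists B r : K, [/\ 0 < B, 0 < r,
    forall k, `|a k| <= B / r ^+ k &
    forall h, `|h| < r -> series (fun k => h ^+ k *: a k) @ \oo --> f (z + h)].
Proof.
move=> /[apply] -[a /nbhs_normP[r0 /= r00 fa]].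
have fah h : `|h| < r0 ->
    series (fun k => h ^+ k *: a k) @ \oo --> f (z + h).
  move=> hr; have /= := fa (z + h); rewrite opprD addrA subrr sub0r normrN.
  move=> /(_ hr); rewrite (_ : (fun k => _) = (fun k => h ^+ k *: a k))//.
  by apply/funext => k; rewrite addrAC subrr add0r.
exists a; pose r := r0 / 2.
have r_gt0 : 0 < r by rewrite divr_gt0.
have rr0 : r < r0 by rewrite gtr_pMr// invf_lt1// ltr1n.
have /cvgP/cvg_seq_bounded : series (fun k => r ^+ k *: a k) @ \oo --> f (z + r).
  by apply: fah; rewrite ger0_norm// ltW.
move=> /pinfty_ex_gt0[M M0 bM]; exists (M + M), r; split => //.
- by rewrite addr_gt0.
- move=> k; rewrite ler_pdivlMr ?exprn_gt0//.
  rewrite mulrC -[X in X * _](@ger0_norm _ (r ^+ k)) ?(exprn_ge0, ltW r_gt0)//.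
  rewrite -normrZ -(seriesSB (fun k => r ^+ k *: a k)).
  by apply: (le_trans (ler_normB _ _)); apply: lerD; exact: bM.
- by move=> h /lt_trans/(_ rr0)/fah.
Qed.

(** Halving the radius turns the coefficient bound into a geometric tail of ratio
at most 1/2. *)
Lemma analytic_on_taylor U f z N : analytic_on U f -> U z ->
  exists a : nat -> X, exists C r : K, [/\ 0 < C, 0 < r &
    forall h, `|h| <= r ->
      `|f (z + h) - \sum_(k < N) h ^+ k *: a k| <= C * `|h| ^+ N].
Proof.
move=> fU Uz; have [a [B [r [B0 r0 aB fa]]]] := analytic_on_coef_bound fU Uz.
exists a, (2 * B / r ^+ N), (r / 2); split=> [||h hr]; rewrite ?divr_gt0//.
- by rewrite mulr_gt0.
- by rewrite exprn_gt0.
have hr1 : `|h| < r by rewrite (le_lt_trans hr)// gtr_pMr// invf_lt1// ltr1n.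
have x2 : `|h| / r <= 2^-1 by rewrite ler_pdivrMr// mulrC.
pose u n := series (fun k => h ^+ k *: a k) n - \sum_(k < N) h ^+ k *: a k.
apply: (@cvg_norm_le_bound u).
- by rewrite realM ?realX ?normr_real// gtr0_real// divr_gt0 ?mulr_gt0 ?exprn_gt0.
- by apply: cvgB; [exact: fa|exact: cvg_cst].
near=> n; have Nn : (N <= n)%N by near: n; exact: nbhs_infty_ge.
rewrite /u -(big_mkord xpredT (fun k => h ^+ k *: a k)) -/(series _ N).
rewrite sub_series_geq// -{1}[N]add0n big_addn big_mkord.
apply: (le_trans (ler_norm_sum _ _ _)).
apply: (@le_trans _ _ (\sum_(i < n - N) B * (`|h| / r) ^+ N * (`|h| / r) ^+ i)).
  apply: ler_sum => i _; rewrite normrZ normrX -mulrA -exprD addnC.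
  rewrite expr_div_n mulrCA ler_wpM2l ?exprn_ge0//.
rewrite -mulr_sumr expr_div_n.
rewrite [leRHS](_ : _ = B * (`|h| ^+ N / r ^+ N) * 2); last first.
  by rewrite mulrC [2 * B]mulrC !mulrA [RHS]mulrAC [in RHS]mulrAC
       -!mulrA mulrCA [2 * _]mulrC.
rewrite ler_wpM2l//; first by rewrite mulr_ge0 ?(ltW B0)// divr_ge0 ?exprn_ge0 ?(ltW r0).
by apply: sum_geometric_le2 => //; rewrite divr_ge0 ?(ltW r0).
Unshelve. all: by end_near. Qed.

Lemma analytic_on_continuous U f z : analytic_on U f -> U z ->
  {for z, continuous f}.
Proof.
move=> fU Uz; have [a [C [r [C0 r0 fa]]]] := analytic_on_taylor 1 fU Uz.
have fz : f z = a 0%N.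
  have := fa 0; rewrite normr0 addr0 big_ord1 expr1 mulr0 expr0 scale1r.
  by move=> /(_ (ltW r0)); rewrite normr_le0 subr_eq0 => /eqP.
apply/(@cvgrPdist_lt _ _ _ (nbhs z)) => e e0.
have eC0 : 0 < e / C by rewrite divr_gt0.
apply: filterS2 (near_dist_lt z r0) (near_dist_lt z eC0) => w /ltW wr we.
rewrite distrC; have := fa (w - z) wr; rewrite (addrC z) subrK big_ord1 expr0 scale1r.
by rewrite fz => /le_lt_trans; apply; rewrite expr1 mulrC -ltr_pdivlMr.
Qed.

Lemma analytic_on_linear (L : {linear X -> X}) U f : continuous L ->
  analytic_on U f -> analytic_on U (L \o f).
Proof.
move=> cL fU z Uz; have [a fa] := fU z Uz; exists (L \o a).
apply: filterS fa => w fw.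
have -> : series (fun k => (w - z) ^+ k *: (L \o a) k) =
    L \o series (fun k => (w - z) ^+ k *: a k).
  apply/funext => n; rewrite /series /= linear_sum.
  by apply: eq_bigr => k _; rewrite linearZ.
by apply: continuous_cvg => //; exact: cL.
Qed.

Lemma analytic_onB U f g : analytic_on U f -> analytic_on U g ->
  analytic_on U (fun z => f z - g z).
Proof.
move=> fU gU z Uz; have [a fa] := fU z Uz; have [b gb] := gU z Uz.
exists (fun k => a k - b k); apply: filterS2 fa gb => w fw gw.
have -> : series (fun k => (w - z) ^+ k *: (a k - b k)) =
    (fun n => series (fun k => (w - z) ^+ k *: a k) n -
              series (fun k => (w - z) ^+ k *: b k) n).
  apply/funext => n; rewrite /series /= -sumrB.
  by apply: eq_bigr => k _; rewrite scalerBr.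
exact: cvgB.
Qed.

End power_series.

(** * Composition with the inversion *)
Section inversion.
Context {K : numFieldType} {X : normedModType K}.
Implicit Types (f : K -> X) (t w z : K).

(** Compactness of discs makes the field archimedean: an element of maximal norm
below all powers of 1/2 could be doubled, hence is 0. *)
Lemma cvg_half_pow : compact_discs K -> (fun n => 2^-1 ^+ n : K) @ \oo --> 0.
Proof.
move=> cK.
have half0 n : 0 < (2^-1 : K) ^+ n by rewrite exprn_gt0 ?invr_gt0.
pose S := \bigcap_(n in [set: nat]) [set z : K | `|z - 0| <= 2^-1 ^+ n].
have cS : compact S.
  apply: (subclosed_compact _ (cK 0 1)); last first.
    by move=> z /(_ 0%N I) /=; rewrite expr0.
  apply: closed_bigI => n _; apply: compact_closed; last exact: cK.
  exact: norm_hausdorff.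
have [|||z Sz zmax] := compact_has_max (u := fun z : K => `|z|) cS.
- by exists 0 => n _ /=; rewrite subrr normr0 ltW.
- by move=> z _; exact: norm_continuous.
- exact: normr_real.
have z0 : z = 0.
  have : `|2 * z| <= `|z|.
    apply: zmax => n _; have /= := Sz n.+1 I; rewrite !subr0 normrM normr_nat.
    by rewrite exprS mulrC ler_pdivlMr// mulrC.
  rewrite normrM normr_nat -subr_le0 mulr_natl mulr2n addrK.
  by rewrite normr_le0 => /eqP.
apply/cvgr0Pnorm_lt => e e0.
have [n ne] : exists n, 2^-1 ^+ n < e.
  apply: contrapT => nle; have : `|e| <= `|z|.
    apply: zmax => n _ /=; rewrite subr0 ger0_norm ?(ltW e0)//.
    rewrite real_leNgt ?gtr0_real//; apply/negP => ne.
    by apply: nle; exists n.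
  by rewrite z0 normr0 normr_le0 gt_eqF.
exists n => // m /= nm; rewrite ger0_norm ?(ltW (half0 m))//.
apply: le_lt_trans ne; apply: ler_wiXn2l nm; rewrite ?invr_ge0//.
by rewrite invf_le1// ler1n.
Qed.

(** [inv_coef k j] is the coefficient of t^j in the expansion of
(t / (1 + t))^k.  The recursion reads off w^(k+1) = t (w^k - w^(k+1)) for
w = t / (1 + t). *)
Fixpoint inv_coef (k j : nat) : K :=
  match j, k with
  | 0%N, 0%N => 1
  | 0%N, _.+1 => 0
  | _.+1, 0%N => 0
  | j'.+1, k'.+1 => inv_coef k' j' - inv_coef k j'
  end.

Lemma inv_coef_small k j : (j < k)%N -> inv_coef k j = 0.
Proof.
elim: j k => [|j IH] [|k]//=; rewrite ltnS => jk.
by rewrite !IH ?subr0// (leq_trans jk).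
Qed.

(** The remainders obey the same recursion as the coefficients, and this gains
a factor 2 |t| at each step, uniformly in [k].  The equation on [w] says that
w = t / (1 + t). *)
Lemma inv_coef_remainder t w k n : w = t * (1 - w) -> `|w| <= 1 ->
  `|w ^+ k - \sum_(j < n) inv_coef k j * t ^+ j| <= (2 * `|t|) ^+ n.
Proof.
move=> wt w1; elim: n k => [|n IH] [|k].
- by rewrite big_ord0 subr0 !expr0 normr1.
- by rewrite big_ord0 subr0 expr0 normrX exprn_ile1.
- rewrite big_ord_recl /= !expr0 mulr1 big1 => [|j _]; last by rewrite mul0r.
  by rewrite addr0 subrr normr0 exprn_ge0// mulr_ge0.
- rewrite big_ord_recl /= mul0r add0r.
  have -> : w ^+ k.+1 - \sum_(j < n)
        (inv_coef k j - inv_coef k.+1 j) * t ^+ (lift ord0 j) =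
      t * ((w ^+ k - \sum_(j < n) inv_coef k j * t ^+ j) -
           (w ^+ k.+1 - \sum_(j < n) inv_coef k.+1 j * t ^+ j)).
    have -> : \sum_(j < n)
        (inv_coef k j - inv_coef k.+1 j) * t ^+ (lift ord0 j) =
        t * (\sum_(j < n) inv_coef k j * t ^+ j -
             \sum_(j < n) inv_coef k.+1 j * t ^+ j).
      rewrite -sumrB mulr_sumr; apply: eq_bigr => j _.
      by rewrite lift0 exprS mulrCA mulrBl.
    have {1}-> : w ^+ k.+1 = t * (w ^+ k - w ^+ k.+1).
      by rewrite exprSr {2}wt; ring.
    by ring.
  rewrite normrM [leRHS]exprS -[leRHS]mulrA [leRHS]mulrCA ler_wpM2l//.
  rewrite (le_trans (ler_normB _ _))// [leRHS]mulr_natl [leRHS]mulr2n.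
  by apply: lerD; exact: IH.
Qed.

Lemma sum_exp_le (D : K) n : 2 <= D -> \sum_(k < n) D ^+ k <= D ^+ n.
Proof.
move=> D2; have D0 : 0 <= D by exact: le_trans D2.
elim: n => [|n IH]; first by rewrite big_ord0 expr0.
rewrite big_ord_recr /= (le_trans (lerD IH (lexx _)))//.
by rewrite -mulr2n -mulr_natl exprS ler_wpM2r ?exprn_ge0.
Qed.

(** With t = (z - z0) / z0 and w = t / (1 + t) one has 1/z - 1/z0 = - w / z0, so
the expansion of [f] at 1/z0 is a power series in w; expanding each power of w
in t and collecting terms gives the expansion at z0.  The n-th partial sums of
the two series differ by the sum over k < n of (remainder of w^k) * a'_k, which
[inv_coef_remainder] bounds by B (2 |t| D)^n. *)
Lemma analytic_on_inv U f : compact_discs K -> analytic_on U f ->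
  analytic_on [set z | z != 0 /\ U z^-1] (fun z => f z^-1).
Proof.
move=> cK fU z0 /= [z0n0 Uz0].
have [a [B [r [B0 r0 aB fa]]]] := analytic_on_coef_bound fU Uz0.
pose a' k := (- z0^-1) ^+ k *: a k.
(* D bounds the growth of a'; taking it at least 2 makes the sum of its powers
   at most its next power. *)
pose D := `|z0^-1| / r + 2.
have D2 : 2 <= D by rewrite lerDr divr_ge0// ltW.
have D0 : 0 < D by rewrite (lt_le_trans _ D2).
have a'B k : `|a' k| <= B * D ^+ k.
  rewrite normrZ normrX normrN.
  apply: (le_trans (ler_wpM2l _ (aB k))); first by rewrite exprn_ge0.
  rewrite mulrCA ler_wpM2l ?(ltW B0)// -expr_div_n.
  by apply: lerXn2r; rewrite ?nnegrE ?(ltW D0) ?divr_ge0 ?(ltW r0)// lerDl.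
exists (fun j => z0 ^- j *: \sum_(k < j.+1) inv_coef k j *: a' k).
have z0D : 0 < `|z0| / (4 * D) by rewrite divr_gt0 ?normr_gt0// mulr_gt0.
apply: filterS (near_dist_lt z0 z0D) => z zz0.
pose t := (z - z0) / z0; pose w := (z - z0) / z.
have t4D : `|t| * (4 * D) <= 1.
  rewrite normf_div mulrAC ler_pdivrMr ?normr_gt0// mul1r ltW//.
  by rewrite -ltr_pdivlMr// mulr_gt0.
have tD : 2 * `|t| * D <= 2^-1.
  have -> : 2 * `|t| * D = `|t| * (4 * D) / 2 by field.
  by rewrite ler_piMl ?invr_ge0.
have t2 : `|t| <= 2^-1.
  rewrite -[leRHS]mul1r ler_pdivlMr// (le_trans _ t4D)// ler_wpM2l//.
  by rewrite (le_trans D2)// ler_peMl ?(ltW D0)// ler1n.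
have zz02 : `|z - z0| <= `|z0| / 2.
  by rewrite -ler_pdivrMl ?normr_gt0// mulrC -normf_div.
have z0z : `|z0| <= 2 * `|z|.
  have : `|z0| <= `|z0| / 2 + `|z|.
    rewrite -{1}(subrK z z0) (le_trans (ler_normD _ _))// lerD2r.
    by rewrite distrC.
  by rewrite {1}(splitr `|z0|) lerD2l ler_pdivrMr// mulrC.
have zn0 : z != 0.
  by apply: contraTneq z0z => ->; rewrite normr0 mulr0 normr_le0.
have w2t : `|w| <= 2 * `|t|.
  rewrite !normf_div ler_pdivrMr ?normr_gt0// mulrAC mulrA.
  rewrite ler_pdivlMr ?normr_gt0// [leRHS]mulrC ler_wpM2l//.
have w1 : `|w| <= 1.
  by rewrite (le_trans w2t)// -ler_pdivlMl// mulr1.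
have wt : w = t * (1 - w) by rewrite /w /t; field; apply/andP.
have zinv : z^-1 = z0^-1 + (- z0^-1) * w by rewrite /w; field; apply/andP.
have sr : `|(- z0^-1) * w| < r.
  have z0r : `|z0^-1| <= D * r by rewrite -ler_pdivrMr// lerDl.
  rewrite normrM normrN (le_lt_trans (ler_pM _ _ z0r w2t))//.
  rewrite (_ : D * r * _ = 2 * `|t| * D * r); last by ring.
  rewrite (le_lt_trans (ler_wpM2r (ltW r0) tD))// mulrC gtr_pMr//.
  by rewrite invf_lt1// ltr1n.
rewrite zinv; have := fa _ sr; set s := _ * w => fs.
set u := series _; rewrite -[u](subrK (series (fun k => s ^+ k *: a k))).
rewrite -[f _]add0r; apply: cvgD => //.
apply/cvgr0Pnorm_lt => e e0.
have eB : 0 < e / B by rewrite divr_gt0.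
have /cvgr0Pnorm_lt/(_ _ eB) := cvg_half_pow cK.
apply: filterS => n; rewrite ger0_norm ?(exprn_ge0, invr_ge0)// ltr_pdivlMr// mulrC.
apply: le_lt_trans.
have -> : (u - series (fun k => s ^+ k *: a k)) n =
   - \sum_(k < n) (w ^+ k - \sum_(j < n) inv_coef k j * t ^+ j) *: a' k.
  change (u n - series (fun k => s ^+ k *: a k) n = - \sum_(k < n)
    (w ^+ k - \sum_(j < n) inv_coef k j * t ^+ j) *: a' k).
  rewrite -opprB; congr (- _); rewrite /u /series /= !big_mkord.
  under [in RHS]eq_bigr do rewrite scalerBl.
  rewrite sumrB; congr (_ - _).
    by apply: eq_bigr => k _; rewrite scalerA -exprMn mulrC.
  under [in RHS]eq_bigr do rewrite scaler_suml.
  rewrite exchange_big /=; apply: eq_bigr => j _.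
  rewrite scalerA -exprVn -exprMn -/t scaler_sumr.
  rewrite -(big_mkord xpredT (fun k => t ^+ j *: (inv_coef k j *: a' k))).
  rewrite (big_nat_widen _ _ n)//= big_mkord big_mkcond /=.
  apply: eq_bigr => k _; case: ltnP => [_|jk]; first by rewrite scalerA mulrC.
  by rewrite inv_coef_small// mul0r scale0r.
rewrite normrN (le_trans (ler_norm_sum _ _ _))//.
apply: (@le_trans _ _ (\sum_(k < n) (2 * `|t|) ^+ n * (B * D ^+ k))).
  apply: ler_sum => k _; rewrite normrZ ler_pM//; exact: inv_coef_remainder.
rewrite -mulr_sumr -mulr_sumr mulrCA ler_wpM2l ?(ltW B0)//.
apply: (@le_trans _ _ ((2 * `|t| * D) ^+ n)).
  by rewrite [leRHS]exprMn ler_wpM2l ?exprn_ge0 ?mulr_ge0// sum_exp_le.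
by apply: lerXn2r => //; rewrite nnegrE ?invr_ge0// !mulr_ge0// (ltW D0).
Qed.

End inversion.

(** * The maximum principle *)
Section maximum_modulus.
Context {K : numClosedFieldType} {X : normedModType K}.
Implicit Types (U : set K) (f : K -> X) (c d h z : K).

Lemma ex_pos_le2 (a b : K) : 0 < a -> 0 < b ->
  exists h, [/\ 0 < h, h <= a & h <= b].
Proof.
move=> a0 b0; have [ab|/ltW ba] := real_leP (gtr0_real a0) (gtr0_real b0).
  by exists a; split.
by exists b; split.
Qed.

Lemma sum_square_vertices (h : K) : \sum_(j < 4) 'i ^+ j * h = 0.
Proof.
rewrite !big_ord_recr big_ord0 /= (exprS _ 2) sqrCi expr0 expr1 mulrN1.
by ring.
Qed.

Lemma sum_square_vertices_sqr (h : K) : \sum_(j < 4) ('i ^+ j * h) ^+ 2 = 0.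
Proof.
rewrite !big_ord_recr big_ord0 /= (exprS _ 2) sqrCi expr0 expr1 mulrN1.
by rewrite !exprMn !sqrrN !sqrCi; ring.
Qed.

Lemma norm_square_vertex (h : K) j : 0 <= h -> `|'i ^+ j * h| = h.
Proof. by move=> h0; rewrite normrM normrX normCi expr1n mul1r ger0_norm. Qed.

(** The parallelogram law for both diagonals of the square. *)
Lemma sum_sqr_dist_square_vertices d h : 0 <= h ->
  \sum_(j < 4) `|d + 'i ^+ j * h| ^+ 2 = 4 * (`|d| ^+ 2 + h ^+ 2).
Proof.
move=> h0.
transitivity (\sum_(j < 4) (`|d| ^+ 2 + h ^+ 2 +
    (d * ('i ^+ j * h)^* + d^* * ('i ^+ j * h)))).
  apply: eq_bigr => j _; rewrite -{2}(norm_square_vertex j h0) !normCK rmorphD /=.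
  by ring.
rewrite big_split /= sumr_const card_ord [RHS]mulr_natl.
rewrite big_split /= -!mulr_sumr -rmorph_sum sum_square_vertices rmorph0.
by rewrite !mulr0 !addr0.
Qed.

(** An approximate mean value inequality over the four vertices of a square
centred at [z].  The Taylor terms of degree 1 and 2 cancel in the average, so the
error is of higher order than h^2. *)
Lemma analytic_on_mean4 U f z : analytic_on U f -> U z ->
  exists C r : K, [/\ 0 < C, 0 < r & forall h, 0 <= h -> h <= r ->
    4 * `|f z| <= \sum_(j < 4) `|f (z + 'i ^+ j * h)| + 4 * (C * h ^+ 3)].
Proof.
move=> fU Uz; have [a [C [r [C0 r0 fa]]]] := analytic_on_taylor 3 fU Uz.
exists C, r; split => // h h0 hr.
have fz : f z = a 0%N.
  have := fa 0; rewrite normr0 addr0 => /(_ (ltW r0)).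
  rewrite expr0n /= mulr0 normr_le0 subr_eq0 => /eqP->.
  by rewrite !big_ord_recl big_ord0 /= expr0 !expr0n /= !scale0r scale1r !addr0.
pose v j := 'i ^+ j * h.
pose R j := f (z + v j) - \sum_(k < 3) v j ^+ k *: a k.
have vh j : `|v j| = h by exact: norm_square_vertex.
have Rh j : `|R j| <= C * h ^+ 3 by rewrite -[in leRHS](vh j) fa// vh.
have -> : 4 * `|f z| = `|\sum_(j < 4) (f (z + v j) - R j)|.
  rewrite mulr_natl -normrMn fz; congr (`|_|).
  transitivity (\sum_(j < 4) \sum_(k < 3) v j ^+ k *: a k); last first.
    by apply: eq_bigr => j _; rewrite /R opprB addrC subrK.
  have S0 : \sum_(j < 4) v j ^+ 0 = 4.
    by under eq_bigr do rewrite expr0; rewrite sumr_const card_ord.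
  have S1 : \sum_(j < 4) v j ^+ 1 = 0 := sum_square_vertices h.
  have S2 : \sum_(j < 4) v j ^+ 2 = 0 := sum_square_vertices_sqr h.
  pose S k := \sum_(j < 4) v j ^+ k.
  transitivity (\sum_(k < 3) S k *: a k); last first.
    rewrite exchange_big; apply: eq_bigr => k _; exact: scaler_suml.
  rewrite !big_ord_recl big_ord0 /= /S S0 S1 S2 !scale0r !addr0.
  by rewrite scaler_nat.
rewrite sumrB (le_trans (ler_normB _ _))// lerD ?ler_norm_sum//.
rewrite (le_trans (ler_norm_sum _ _ _))//.
by rewrite (le_trans (ler_sum _ (fun (j : 'I_4) _ => Rh j)))//
     sumr_const card_ord mulr_natl.
Qed.

Lemma cvg_dist (c z : K) : `|w - c| @[w --> z] --> `|z - c|.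
Proof.
apply/(@cvgrPdist_lt _ _ _ (nbhs z)) => e e0.
apply: filterS (near_dist_lt z e0) => w; apply: le_lt_trans.
by rewrite (le_trans (ler_dist_dist _ _))// opprB addrA subrK distrC.
Qed.

(** If |f| exceeded [m] inside the disc, then |f z| + e |z - c|^2 would, for small
e, attain its maximum over the disc at an interior point z0.  Averaging over a
small square centred at z0, the quadratic term gains e h^2, whereas |f| loses at
most C h^3: impossible for h small. *)
Lemma maximum_modulus U f (c r m : K) : compact_discs K ->
  analytic_on U f -> [set z | `|z - c| <= r] `<=` U -> 0 < r ->
  (forall z, `|z - c| = r -> `|f z| <= m) ->
  forall z, `|z - c| <= r -> `|f z| <= m.
Proof.
move=> cK fU DU r0 fm z1 z1r.
have mr : m \is Num.real.
  rewrite ger0_real// (le_trans _ (fm (c + r) _))//.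
  by rewrite addrAC subrr add0r gtr0_norm.
rewrite real_leNgt ?normr_real//; apply/negP => mf.
(* e is chosen so that m + e r^2 is the midpoint of m and |f z1|. *)
pose e := (`|f z1| - m) / (2 * r ^+ 2).
have r20 : 0 < 2 * r ^+ 2 by rewrite mulr_gt0 ?exprn_gt0.
have e0 : 0 < e by rewrite divr_gt0// subr_gt0.
have er : m + e * r ^+ 2 < `|f z1|.
  have -> : e * r ^+ 2 = (`|f z1| - m) / 2.
    by rewrite /e; field; rewrite gt_eqF.
  by rewrite -ltrBrDl gtr_pMr ?subr_gt0// invf_lt1// ltr1n.
pose u z := `|f z| + e * `|z - c| ^+ 2.
have [||z|z0 /= z0r umax] := compact_has_max (u := u) (cK c r).
- by exists z1.
- move=> z /= /DU Uz.
  have cf : `|f w| @[w --> z] --> `|f z|.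
    exact: cvg_norm (analytic_on_continuous fU Uz).
  have cd : `|w - c| @[w --> z] --> `|z - c| by exact: cvg_dist.
  exact: cvgD cf (cvgMr (cvgM cd cd)).
- apply: realD; first exact: normr_real.
  by apply: realM; [exact: gtr0_real|apply: realX; exact: normr_real].
have uz1 : `|f z1| <= u z0.
  by rewrite (le_trans _ (umax _ z1r))// lerDl mulr_ge0 ?exprn_ge0// ltW.
have {}z0r : `|z0 - c| < r.
  rewrite lt_neqAle z0r andbT; apply/eqP => z0r'.
  suff /(le_lt_trans uz1) : u z0 < `|f z1| by rewrite ltxx.
  by apply: le_lt_trans er; rewrite /u z0r' lerD2r fm.
have Uz0 : U z0 by apply: DU; exact: ltW.
have [C [rho [C0 rho0 mean]]] := analytic_on_mean4 fU Uz0.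
have s0 : 0 < r - `|z0 - c| by rewrite subr_gt0.
have eC0 : 0 < e / (2 * C) by rewrite divr_gt0// mulr_gt0.
have [h1 [h10 h1s h1rho]] := ex_pos_le2 s0 rho0.
have [h [h0 hh1 heC]] := ex_pos_le2 h10 eC0.
have uh j : u (z0 + 'i ^+ j * h) <= u z0.
  apply: umax; rewrite /= addrAC (le_trans (ler_normD _ _))//.
  by rewrite norm_square_vertex ?(ltW h0)// -lerBrDl (le_trans hh1).
have Su : \sum_(j < 4) u (z0 + 'i ^+ j * h) <= 4 * u z0.
  by rewrite (le_trans (ler_sum _ (fun (j : 'I_4) _ => uh j)))//
       sumr_const card_ord mulr_natl.
have {}mean := mean h (ltW h0) (le_trans hh1 h1rho).
have Sd : \sum_(j < 4) `|z0 + 'i ^+ j * h - c| ^+ 2 =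
    4 * (`|z0 - c| ^+ 2 + h ^+ 2).
  rewrite -(sum_sqr_dist_square_vertices _ (ltW h0)); apply: eq_bigr => j _.
  by rewrite addrAC.
move: Su; rewrite /u big_split /= -mulr_sumr Sd => Su.
have : 4 * `|f z0| + e * (4 * (`|z0 - c| ^+ 2 + h ^+ 2)) <=
    4 * (`|f z0| + e * `|z0 - c| ^+ 2) + 4 * (C * h ^+ 3).
  rewrite (le_trans (lerD mean (lexx _)))// addrAC lerD2r//.
rewrite -subr_le0 (_ : _ - _ = 4 * h ^+ 2 * (e - C * h)); last by ring.
rewrite pmulr_rle0 ?mulr_gt0 ?exprn_gt0// subr_le0 => eCh.
have := le_trans eCh (ler_wpM2l (ltW C0) heC).
rewrite (_ : C * _ = e / 2); last by field; rewrite gt_eqF.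
suff /[swap]/le_lt_trans/[apply] : e / 2 < e by rewrite ltxx.
by rewrite gtr_pMr// invf_lt1// ltr1n.
Qed.

(** The maximum principle bounds [g n] near [c] by its values on a circle around
[c], which is a compact set avoiding [c]. *)
Lemma vanishes_at_removable U (g : nat -> K -> X) c : compact_discs K ->
  open U -> U c -> (forall n, analytic_on U (g n)) ->
  (forall z, U z -> z != c -> vanishes_at g z) -> vanishes_at g c.
Proof.
move=> cK oU Uc gU van e e0.
have /nbhs_normP[r /= r0 rU] : nbhs c U by exact: open_nbhs_nbhs.
have r20 : 0 < r / 2 by rewrite divr_gt0.
have DU : [set w | `|w - c| <= r / 2] `<=` U.
  move=> w /= wr; apply: rU; rewrite /= distrC (le_lt_trans wr)//.
  by rewrite gtr_pMr// invf_lt1// ltr1n.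
have closed1 (x : K) : closed [set x].
  apply: (accessible_finite_set_closed.1 _ _ (finite_set1 _)).
  by apply: hausdorff_accessible; exact: norm_hausdorff.
pose S := [set w | `|w - c| = r / 2].
have cS : compact S.
  apply: (subclosed_compact _ (cK c (r / 2))); last first.
    by move=> w /= ->.
  apply: (@preimage_closed _ _ (fun w => `|w - c|) [set r / 2]).
    by move=> w _; exact: cvg_dist.
  exact: closed1.
have oV : open (U `\ c) by rewrite setDE; apply: openI => //; exact: closed_openC.
have gV : cvg_compacts_to0 (U `\ c) g.
  by apply/(cvg_compacts_to0P g cK oV) => z [Uz /eqP zc]; exact: van.
have SV : S `<=` U `\ c.
  rewrite /S => w /= wr; split; first by apply: DU; rewrite /= wr.
  by move=> wc; move: wr r20; rewrite wc subrr normr0 => <-; rewrite ltxx.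
have e20 : 0 < e / 2 by rewrite divr_gt0.
have /uniform_cvg0P/(_ _ e20)[N _ gN] := gV S cS SV.
exists ([set n | (N <= n)%N], [set w | `|w - c| < r / 2]) => /=.
  by split; [exists N|exact: near_dist_lt].
move=> [n w] /= [Nn wr]; apply: (@le_lt_trans _ _ (e / 2)); last first.
  by rewrite gtr_pMr// invf_lt1// ltr1n.
apply: (maximum_modulus cK (gU n) DU r20); last exact: ltW.
by move=> z zS; apply/ltW/gN.
Qed.

End maximum_modulus.

(** * Discs of the complex plane are compact *)
Lemma closed_disc (K : numFieldType) (z r : K) : r \is Num.real ->
  closed [set w : K | `|w - z| <= r].
Proof.
move=> rr w /= cw; rewrite real_leNgt ?normr_real//; apply/negP => wr.
have d0 : 0 < `|w - z| - r by rewrite subr_gt0.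
have [v [/= vr vw]] := cw _ (near_dist_lt w d0).
have : `|w - z| < `|w - z|.
  rewrite -{1}(subrK v w) -addrA (le_lt_trans (ler_normD _ _))//.
  by rewrite -ltrBrDr (lt_le_trans _ (lerB (lexx _) vr))// distrC.
by rewrite ltxx.
Qed.

Lemma complex_norm_le (R : realType) (a b : R) :
  `|a +i* b| <= (`|a| + `|b|)%:C.
Proof.
rewrite normc_def lecR /= -[leRHS]ger0_norm ?addr_ge0// -sqrtr_sqr.
rewrite ler_wsqrtr// sqrrD !real_normK ?num_real// lerD2r lerDl.
by rewrite mulrn_wge0 ?mulr_ge0.
Qed.

(** The disc is closed in a square, the continuous image of a product of segments. *)
Lemma compact_complex_disc (R : realType) :
  compact_discs (R[i] : numFieldType).
Proof.
move=> z r.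
have [r0|rN0] := boolP (0 <= r); last first.
  rewrite (_ : [set _ | _] = set0); first exact: compact0.
  apply/seteqP; split => // w /= wr; move: rN0.
  by rewrite (le_trans (normr_ge0 _) wr).
have rr : r \is Num.real by exact: ger0_real.
pose rho := complex.Re r.
have rE : r = rho%:C by rewrite RRe_real.
pose g (p : R * R) : (R[i] : numFieldType) := z + p.1 +i* p.2.
have cg : continuous g.
  move=> [a b]; apply/(@cvgrPdist_lt _ _ _ (nbhs (a, b))) => e e0.
  have eE : (complex.Re e)%:C = e by rewrite RRe_real// gtr0_real.
  pose d := complex.Re e / 2.
  have d0 : 0 < d by rewrite divr_gt0// -ltcR eE.
  exists ([set x | `|x - a| < d], [set y | `|y - b| < d]) => /=.
    by split; exact: near_dist_lt.
  move=> [x y] /= [xa yb]; rewrite /g /= distrC.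
  rewrite opprD addrACA subrr add0r -eE (splitr (complex.Re e)).
  by rewrite (le_lt_trans (complex_norm_le _ _))// ltcR ltrD.
have cQ : compact (g @` (`[- rho, rho] `*` `[- rho, rho])).
  apply: continuous_compact; first exact: continuous_subspaceT.
  by apply: compact_setX; exact: segment_compact.
apply: (subclosed_compact _ cQ); first exact: closed_disc.
move=> w /= wr; exists (complex.Re (w - z), complex.Im (w - z)).
  split => /=; rewrite in_itv /= -ler_norml -lecR -rE (le_trans _ wr)//.
    by rewrite normc_def lecR -sqrtr_sqr ler_wsqrtr// lerDl sqr_ge0.
  by rewrite normc_def lecR -sqrtr_sqr ler_wsqrtr// lerDr sqr_ge0.
rewrite /g /=; case: (w - z) (subrK z w) => a b /= <-.
by rewrite addrC.
Qed.

(** * Bounded operators and locally uniform limits *)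
Section bounded_operators.
Context {K : numFieldType} {X : normedModType K}.
Implicit Types (T : {linear X -> X}) (g q y : nat -> K -> X).

Lemma bounded_operator_gt0 T : bounded_operator T ->
  exists2 M : K, 0 < M & forall x, `|T x| <= M * `|x|.
Proof.
move=> [M TM]; exists (`|M| + 1) => [|x]; first by rewrite ltr_wpDl.
have [->|x0] := eqVneq x 0; first by rewrite linear0 !normr0 mulr0.
have M0 : 0 <= M.
  have : 0 <= M * `|x| by rewrite (le_trans _ (TM x)).
  by rewrite pmulr_lge0 ?normr_gt0.
by rewrite (le_trans (TM x))// ler_wpM2r// ger0_norm// lerDl.
Qed.

Lemma bounded_operator_continuous T : bounded_operator T -> continuous T.
Proof.
move=> /bounded_operator_gt0[M M0 TM] x.
apply/cvgrPdist_lt => e e0; have eM : 0 < e / M by rewrite divr_gt0.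
apply/nbhs_normP; exists (e / M) => // y /= xy.
by rewrite -linearB (le_lt_trans (TM _))// mulrC -ltr_pdivlMr.
Qed.

Lemma vanishes_at_linear T g z : bounded_operator T ->
  vanishes_at g z -> vanishes_at (fun n w => T (g n w)) z.
Proof.
move=> /bounded_operator_gt0[M _ TM]; apply: (@vanishes_at_le _ _ _ _ M).
by apply: filterE => -[n w].
Qed.

(** The lower bound 1/C of z - B, where [y n w] stands for B (q n w), persists with
constant 1/(2C) for |w - z| < 1/(2C). *)
Lemma vanishes_at_bounded_below q y (C z : K) : 0 < C ->
  (forall n w, `|q n w| <= C * `|z *: q n w - y n w|) ->
  vanishes_at (fun n w => w *: q n w - y n w) z -> vanishes_at q z.
Proof.
move=> C0 qC; apply: (@vanishes_at_le _ _ _ _ (2 * C)).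
have d0 : 0 < (2 * C)^-1 by rewrite invr_gt0 mulr_gt0.
exists ([set: nat], [set w | `|w - z| < (2 * C)^-1]) => /=.
  by split; [exact: filterT|exact: near_dist_lt].
move=> [n w] /= [_ wz].
have : `|q n w| <= C * `|w *: q n w - y n w| + `|q n w| / 2.
  rewrite (le_trans (qC n w))//.
  have -> : z *: q n w - y n w = (w *: q n w - y n w) + (z - w) *: q n w.
    by rewrite scalerBl [RHS]addrC addrA subrK.
  rewrite (le_trans (ler_wpM2l (ltW C0) (ler_normD _ _)))// mulrDr lerD2l.
  rewrite normrZ distrC mulrA mulrC ler_wpM2l//.
  rewrite (le_trans (ler_wpM2l (ltW C0) (ltW wz)))//.
  by rewrite invfM mulrCA divff ?mulr1// gt_eqF.
rewrite {1}(splitr `|q n w|) lerD2r ler_pdivrMr// => /le_trans; apply.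
by rewrite mulrC mulrA.
Qed.

End bounded_operators.

(** * Transfer of property (beta) *)
Section drazin.
Context {K : numClosedFieldType} {X : normedModType K}.
Implicit Types (A B T S : {linear X -> X}) (U : set K) (g : nat -> K -> X).

Lemma near_neq0 (z : K) : z != 0 -> \forall w \near z, w != 0.
Proof.
rewrite -normr_gt0 => /(near_dist_lt z); apply: filterS => w.
by apply: contraTneq => ->; rewrite sub0r normrN ltxx.
Qed.

Lemma open_inv U : open U -> open [set z : K | z != 0 /\ U z^-1].
Proof.
move=> oU; rewrite openE => z /= [z0 Uz].
apply: filterI; first exact: near_neq0.
by apply: (inv_continuous z0); exact: open_nbhs_nbhs.
Qed.

(** The part of the space where [A] inverts [B]. At z = 0 the identity g = A (B g)
bounds [B] from below; elsewhere h_n(mu) = g_n(1/mu) satisfies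
(mu - A) h_n(mu) = - mu A (1/mu - B) g_n(1/mu), so property (beta) of [A]
applies to it. *)
Lemma property_beta_vanishes_inverse A B U g : compact_discs K ->
  bounded_operator A -> property_beta A -> open U ->
  (forall n, analytic_on U (g n)) -> (forall n w, A (B (g n w)) = g n w) ->
  (forall z, U z -> vanishes_at (fun n w => w *: g n w - B (g n w)) z) ->
  forall z, U z -> vanishes_at g z.
Proof.
move=> cK bA betaA oU gU ABg van z Uz.
have [M M0 AM] := bounded_operator_gt0 bA.
have [z0|z0] := eqVneq z 0.
  apply: (vanishes_at_bounded_below M0 _ (van z Uz)) => n w.
  by rewrite z0 scale0r sub0r normrN -{1}ABg.
pose V := [set mu | mu != 0 /\ U mu^-1].
have oV : open V := open_inv oU.
pose h n (mu : K) := g n mu^-1.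
have hV n : analytic_on V (h n) by exact: analytic_on_inv.
have hA : cvg_compacts_to0 V (fun n mu => mu *: h n mu - A (h n mu)).
  apply/(cvg_compacts_to0P _ cK oV) => mu /= [mu0 Umu].
  have := vanishes_at_comp (inv_continuous mu0) (van _ Umu).
  apply: (@vanishes_at_le _ _ _ _ ((`|mu| + 1) * M)).
  exists ([set: nat], [set w | `|w - mu| < 1] `&` [set w | w != 0]) => /=.
    split; first exact: filterT.
    by apply: filterI; [exact: near_dist_lt|exact: near_neq0].
  move=> [n w] /= [_ [w1 w0]]; rewrite /h.
  have -> : w *: g n w^-1 - A (g n w^-1) =
      - (w *: A (w^-1 *: g n w^-1 - B (g n w^-1))).
    rewrite [A (_ - _)]linearB [A (_ *: _)]linearZ /= ABg.
    by rewrite scalerBr scalerA divff// scale1r opprB.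
  rewrite normrN normrZ -mulrA ler_pM//.
  rewrite -{1}(subrK mu w) (le_trans (ler_normD _ _))// addrC lerD2l.
  exact: ltW.
have Vz : V z^-1 by split; rewrite ?invr_eq0// invrK.
have /(cvg_compacts_to0P _ cK oV)/(_ _ Vz) := betaA V oV h hV hA.
move=> /(vanishes_at_comp (inv_continuous z0)).
rewrite (_ : (fun n w => h n w^-1) = g)//.
by apply/funext => n; apply/funext => w; rewrite /h invrK.
Qed.

(** [A \o B] is the projection along which the space splits.  On its range [A]
inverts [B]; on its kernel [z - B] is bounded below off the origin, and the
origin is then a removable point. *)
Lemma property_beta_transfer A B : compact_discs K ->
  bounded_operator A -> bounded_operator B ->
  (forall x, A (B x) = B (A x)) ->
  (forall x, A (B (A (B x))) = A (B x)) ->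
  (forall z, z != 0 -> exists2 C : K, 0 < C &
     forall x, A (B x) = 0 -> `|x| <= C * `|z *: x - B x|) ->
  property_beta A -> property_beta B.
Proof.
move=> cK bA bB AB_BA ABid below betaA U oU f fU.
move=> /(cvg_compacts_to0P _ cK oU) van; apply/(cvg_compacts_to0P _ cK oU).
have cA := bounded_operator_continuous bA.
have cB := bounded_operator_continuous bB.
pose g n w := A (B (f n w)); pose q n w := f n w - g n w.
have gU n : analytic_on U (g n).
  exact: (analytic_on_linear cA (analytic_on_linear cB (fU n))).
have qU n : analytic_on U (q n) by exact: analytic_onB.
have gE n w : w *: g n w - B (g n w) = A (B (w *: f n w - B (f n w))).
  by rewrite !linearB !linearZ /= /g -[B (A (B _))]AB_BA.
have vang z : U z ->
    vanishes_at (fun n w => w *: g n w - B (g n w)) z.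
  move=> Uz; under eq_fun do under eq_fun do rewrite gE.
  exact: (vanishes_at_linear bA (vanishes_at_linear bB (van z Uz))).
have vanq z : U z ->
    vanishes_at (fun n w => w *: q n w - B (q n w)) z.
  move=> Uz.
  have -> : (fun n w => w *: q n w - B (q n w)) =
      (fun n w => (w *: f n w - B (f n w)) - (w *: g n w - B (g n w))).
    apply/funext => n; apply/funext => w.
    rewrite /q [B (_ - _)]linearB scalerBr !opprB.
    by rewrite [LHS]addrACA [RHS]addrACA; congr (_ + _); rewrite addrC.
  apply: vanishes_atD; first exact: van.
  apply: (@vanishes_at_le _ _ _ _ 1 _ _ (vang z Uz)).
  by apply: filterE => -[n w] /=; rewrite normrN mul1r.
have g0 : forall z, U z -> vanishes_at g z.
  by apply: (property_beta_vanishes_inverse cK bA betaA) vang => // n w; exact: ABid.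
have q0n z : U z -> z != 0 -> vanishes_at q z.
  move=> Uz /below[C C0 Cq].
  apply: (vanishes_at_bounded_below C0 _ (vanq z Uz)) => n w; apply: Cq.
  by rewrite /q /g !linearB /= ABid subrr.
have q0 z : U z -> vanishes_at q z.
  move=> Uz; have [z0|] := eqVneq z 0; last exact: q0n.
  apply: (vanishes_at_removable cK oU Uz qU) => w Uw wz.
  by apply: q0n => //; rewrite -z0.
move=> z Uz; have := vanishes_atD (g0 z Uz) (q0 z Uz).
rewrite (_ : (fun n w => _) = f)//.
by apply/funext => n; apply/funext => w; rewrite /q addrC subrK.
Qed.

(** On the kernel of T S the operator S vanishes, so that z - S is z; and T is - Q
there, so that z - T is - (- z - Q), which has a bounded inverse for z nonzero. *)
Lemma generalized_drazin_inverse_beta T S : compact_discs K ->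
  bounded_operator T -> generalized_drazin_inverse T S ->
  property_beta T <-> property_beta S.
Proof.
move=> cK bT [bS ST_TS STS [Q [bQ qQ TST]]]; split.
- apply: property_beta_transfer => // [x|z z0]; rewrite ?STS//.
  exists `|z|^-1 => [|x TSx]; first by rewrite invr_gt0 normr_gt0.
  rewrite -(STS x) TSx linear0 subr0 normrZ mulrA mulVf ?mul1r//.
  by rewrite normr_eq0.
- apply: property_beta_transfer => // z z0.
  have : ~ spectrum Q (- z).
    by rewrite qQ /= => /eqP; rewrite oppr_eq0; apply/negP.
  move=> /contrapT[R /bounded_operator_gt0[M M0 RM] [RQ _]].
  exists M => // x STx; rewrite -{1}(RQ x) (le_trans (RM _))//.
  have TxQ : T x + Q x = 0 by rewrite -TST STx linear0.
  have -> : z *: x - T x = z *: x + Q x.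
    by move/eqP: TxQ; rewrite addr_eq0 => /eqP->; rewrite opprK.
  by rewrite scaleNr -opprD normrN.
Qed.

End drazin.

Theorem theorem4p8 (R : realType) (X : completeNormedModType R[i])
    (infX : infinite_dimensional X)
    (T TD : {linear X -> X}) (bT : bounded_operator T)
    (TTD : generalized_drazin_inverse T TD) :
  property_beta T <-> property_beta TD.
Proof.
exact: (generalized_drazin_inverse_beta (@compact_complex_disc R) bT TTD).
Qed.
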